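(* Let $V$ be a non-zero finite-dimensional real $\mathbb{Z}$-graded vector space with graded dimension $(r_j)_{j\in\mathbb{Z}}$, $r_j=\dim V_j$, and total dimension $n=\sum_jr_j$, equipped with a degree $\ell$ metric $g$. Let $k:=-\lfloor\ell/2\rfloor\in\mathbb{Z}$ and $\epsilon:=\ell\bmod 2\in\{0,1\}$, so that $\ell=-2k+\epsilon$. (i) If $\epsilon=1$ and $k$ is arbitrary, or $\epsilon=0$ and $k$ is odd, there exists a total basis $(t_\alpha)_{\alpha=1}^{n/2}\cup(\overline{t}_\beta)_{\beta=1}^{n/2}$ of $V$ such that $|t_\alpha|\ge k$, $|\overline{t}_\beta|=-|t_\beta|+2k-\epsilon$, and $g(t_\alpha,\overline{t}_\beta)=\delta_{\alpha\beta}$, with all other values of $g$ on basis vectors either zero or obtained from these by the graded symmetry of $g$. (ii) If $\epsilon=0$ and $k$ is even, there exists a total basis $(t_\alpha)_{\alpha=1}^{m/2}\cup(\overline{t}_\beta)_{\beta=1}^{m/2}\cup(e_a)_{a=1}^{r_k}$ of $V$, where $m=n-r_k$, such that $|t_\alpha|>k$, $|\overline{t}_\beta|=-|t_\beta|+2k$, $|e_a|=k$, and $g(t_\alpha,\overline{t}_\beta)=\delta_{\alpha\beta}$, $g(e_a,e_b)=\eta_{ab}$, where $\eta_{ab}$ is a Minkowski metric of some signature $(p,q)$ with $p+q=r_k$, with all other values of $g$ on basis vectors either zero or obtained from these by the graded symmetry of $g$.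
   Context: A graded vector space is a sequence $V=(V_j)_{j\in\mathbb{Z}}$ of real vector spaces with $\sum_j\dim V_j<\infty$; $|v|$ is the degree of a homogeneous element. A total basis of $V$ is a union of bases of the components $V_j$. $V^*$ is the graded dual, $(V^* )_j=(V_{-j})^*$. A degree $\ell$ metric on $V$ is a bilinear map $g:V\times V\to\mathbb{R}$ with $g(v,w)=0$ unless $|v|+|w|+\ell=0$, with graded symmetry $g(v,w)=(-1)^{(|v|+\ell)(|w|+\ell)}g(w,v)$, and such that the degree $\ell$ map $g_\flat:V\to V^*$, $[g_\flat(v)](w):=(-1)^{(|v|+1)\ell}g(v,w)$, is an isomorphism (i.e. each component $V_j\to(V_{-(j+\ell)})^*$ is an isomorphism). A Minkowski metric of signature $(p,q)$ is the diagonal matrix with $p$ entries $+1$ and $q$ entries $-1$. *)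

(* Defs.v *)
From HB Require Import structures.
From mathcomp Require Import all_boot all_order all_algebra.
From mathcomp Require Import all_classical all_reals.

Set Implicit Arguments.
Unset Strict Implicit.
Unset Printing Implicit Defensive.

Import Order.TTheory GRing.Theory Num.Theory.
Local Open Scope ring_scope.

(* Each component is a finite-dimensional [vectType]; together with the
   finiteness of the support this is the condition sum_j dim V_j < oo. *)
Record gradedVect (R : realType) := GradedVect {
  gcomp :> int -> vectType R;
  gcomp_fin : finite_set [set j | \dim {: gcomp j} != 0%N]%classic }.

Definition gdim (R : realType) (V : gradedVect R) (j : int) : nat :=
  \dim {: V j}.

(* A finitely supported sum over all of [int]. *)
Definition tdim (R : realType) (V : gradedVect R) : nat :=
  \big[addn/0%N]_(j \in [set: int]%classic) gdim V j.

Definition gdual (R : realType) (V : gradedVect R) (j : int) : vectType R :=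
  'Hom(V (- j), R^o).

(* Homogeneous elements, tagged with their degree. *)
Definition homog (R : realType) (V : gradedVect R) := {j : int & V j}.

Definition hdeg (R : realType) (V : gradedVect R) (x : homog V) : int := tag x.

(* A bilinear map on the graded space V is given by its restrictions to the
   products V_i x V_j. *)
Definition gbilinear (R : realType) (V : gradedVect R) :=
  forall i j : int, {bilinear V i -> V j -> R | *%R & *%R}.

Definition gflat (R : realType) (V : gradedVect R) (l : int)
    (g : gbilinear V) (j : int) (v : V j) : gdual V (j + l) :=
  linfun (fun w : V (- (j + l)) => (-1) ^ ((j + 1) * l) * g _ _ v w : R^o).

Lemma gflatE (R : realType) (V : gradedVect R) (l : int) (g : gbilinear V)
    (j : int) (v : V j) (w : V (- (j + l))) :
  (gflat l g v : 'Hom(V (- (j + l)), R^o)) w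
    = (-1) ^ ((j + 1) * l) * g _ _ v w.
Proof.
rewrite /gflat; set f := fun _ => _.
have fL : linear (f : _ -> R^o).
  by move=> a u u'; rewrite /f linearPr mulrDr mulrCA.
pose F := GRing.isLinear.Build _ _ _ _ (f : _ -> R^o) fL.
pose f' : {linear V (- (j + l)) -> R^o} := HB.pack (f : _ -> R^o) F.
exact: (lfunE f').
Qed.

(* [gflat] is linear by bilinearity, so its components are isomorphisms as
   soon as they are bijective. *)
Record gmetric (R : realType) (V : gradedVect R) (l : int) := GMetric {
  gform : gbilinear V;
  gform_deg : forall (i j : int) (v : V i) (w : V j),
    i + j + l != 0 -> gform _ _ v w = 0;
  gform_sym : forall (i j : int) (v : V i) (w : V j),
    gform _ _ v w = (-1) ^ ((i + l) * (j + l)) * gform _ _ w v;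
  gform_flat : forall j : int, bijective (@gflat R V l gform j) }.

Definition geval (R : realType) (V : gradedVect R) (l : int)
    (g : gmetric V l) (x y : homog V) : R :=
  gform g _ _ (tagged x) (tagged y).

(* For every j, the members of degree j of the family form a basis of V_j;
   [untag] only casts such a member to the type V_j. *)
Definition total_basis (R : realType) (V : gradedVect R) (I : finType)
    (b : I -> homog V) : Prop :=
  forall j : int,
    basis_of {: V j}
      [seq untag 0 (fun v : V j => v) (b i) | i <- enum I & hdeg (b i) == j].

Definition joinf (T I J : Type) (f : I -> T) (h : J -> T) (x : I + J) : T :=
  match x with inl i => f i | inr j => h j end.

Definition minkowski (R : realType) (p q : nat) : 'M[R]_(p + q) :=
  block_mx 1%:M 0 0 (- 1%:M).

(* Main.v *)
(* A family put in normal form is extended greedily. Such a family has a dual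
   family up to signs, so it is free and orthogonal projection onto its
   complement is available. If it does not span, projecting a missing vector x
   and a vector y with g(x, y) = 1 (nondegeneracy) gives a pair orthogonal to the
   family, and y lies in degree -(|x| + l). If |x| <> |y|, or if the form on the
   self-paired degree is skew, then x and y are isotropic and can be adjoined as
   a hyperbolic pair; otherwise the form is symmetric there, and one of x, y,
   x + y is anisotropic and can be adjoined after scaling. The process stops
   because free families have at most tdim V members. *)
Require Import Defs.
From HB Require Import structures.
From mathcomp Require Import all_boot all_order all_algebra zify.
From mathcomp Require Import all_classical all_reals.

Set Implicit Arguments.
Unset Strict Implicit.
Unset Printing Implicit Defensive.

Import Order.TTheory GRing.Theory Num.Theory.
Local Open Scope ring_scope.

(** * Homogeneous components and counting over degrees *)

Definition homog_of (R : realType) (V : gradedVect R) (j : int) (v : V j) :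
  homog V := Tagged (fun i => V i) v.

(** The value is 0 when [x] has another degree, so components can be summed in [V j] without
    transporting along equalities of degrees. *)
Definition hcomp (R : realType) (V : gradedVect R) (j : int) (x : homog V) : V j :=
  untag 0 (fun v : V j => v) x.

Lemma hcomp_homog_of (R : realType) (V : gradedVect R) (j : int) (v : V j) :
  hcomp j (homog_of v) = v.
Proof. by rewrite /hcomp untagE. Qed.

Lemma hcomp_neq (R : realType) (V : gradedVect R) (j : int) (x : homog V) :
  hdeg x != j -> hcomp j x = 0.
Proof. exact: untag_dflt. Qed.

Lemma total_basis_reindex (R : realType) (V : gradedVect R) (I J : finType)
    (b : I -> homog V) (f : J -> I) :
  bijective f -> total_basis b -> total_basis (b \o f).
Proof.
move=> f_bij b_basis j.
have f_enum : perm_eq (enum I) [seq f a | a <- enum J].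
  apply: uniq_perm; rewrite ?(map_inj_uniq (bij_inj f_bij)) ?enum_uniq //.
  move=> i; rewrite mem_enum; apply/esym/mapP.
  by case: f_bij => f' _ f'K; exists (f' i); rewrite ?mem_enum ?f'K.
have := perm_map (hcomp j \o b) (perm_filter (fun i => hdeg (b i) == j) f_enum).
move=> /perm_basis b_f; have := b_basis j; rewrite {}b_f.
by rewrite filter_map -map_comp.
Qed.

Lemma eq_total_basis (R : realType) (V : gradedVect R) (I : finType)
    (b b' : I -> homog V) :
  b =1 b' -> total_basis b -> total_basis b'.
Proof. by move=> /funext ->. Qed.

Lemma tdim_bigE (R : realType) (V : gradedVect R) :
  exists js : seq int, [/\ uniq js, forall j, gdim V j != 0%N -> j \in js
    & tdim V = (\sum_(j <- js) gdim V j)%N].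
Proof.
have fin := gcomp_fin V.
exists (finmap.enum_fset (fset_set [set j | gdim V j != 0%N]%classic)).
split; first exact: finmap.fset_uniq.
  by move=> j j0; rewrite in_fset_set // inE.
rewrite -fsbig_finite //; apply/esym/fsbig_widen => // j [_ /=].
by case: eqP.
Qed.

(** Double counting: each index is counted once, under its own degree. *)
Lemma card_homog_family (R : realType) (V : gradedVect R) (K : finType)
    (b : K -> homog V) (js : seq int) :
  uniq js -> (forall i, hdeg (b i) \in js) ->
  #|K| = (\sum_(j <- js) size
    [seq hcomp j (b i) | i <- enum K & hdeg (b i) == j])%N.
Proof.
move=> js_uniq b_js; rewrite cardE -[LHS]sum1_size.
rewrite (eq_bigr (fun i => \sum_(j <- js | hdeg (b i) == j) 1)%N); last first.
  move=> i _; rewrite sum1_count (eq_count (a2 := pred1 (hdeg (b i)))).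
    by rewrite count_uniq_mem // b_js.
  by move=> j; rewrite /= eq_sym.
rewrite (exchange_big_dep xpredT) //=; apply: eq_bigr => j _.
by rewrite size_map size_filter sum1_count.
Qed.

(** * The pairing: degrees, symmetry and nondegeneracy *)

Section Metric.
Variables (R : realType) (V : gradedVect R) (l : int) (g : gmetric V l).
Implicit Types x y z : homog V.

Lemma geval_deg x y : hdeg x + hdeg y + l != 0 -> geval g x y = 0.
Proof. exact: gform_deg. Qed.

Lemma geval_sym x y :
  geval g x y = (-1) ^ ((hdeg x + l) * (hdeg y + l)) * geval g y x.
Proof. exact: gform_sym. Qed.

Lemma geval_sym_eq0 x y : geval g x y = 0 -> geval g y x = 0.
Proof. by rewrite [geval g y x]geval_sym => ->; rewrite mulr0. Qed.

Lemma gform_hcompl j x y :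
  gform g j _ (hcomp j x) (tagged y) = (hdeg x == j)%:R * geval g x y.
Proof.
have [<-|ne] := eqVneq (hdeg x) j.
  by case: x => i v; rewrite hcomp_homog_of mul1r.
by rewrite hcomp_neq // linear0l mul0r.
Qed.

Lemma gform_hcompr j x y :
  gform g _ j (tagged x) (hcomp j y) = (hdeg y == j)%:R * geval g x y.
Proof.
have [<-|ne] := eqVneq (hdeg y) j.
  by case: y => i v; rewrite hcomp_homog_of mul1r.
by rewrite hcomp_neq // linear0r mul0r.
Qed.

(** If [v] paired to 0 with everything, [gflat] would send [v] and 0 to the same functional, against
    injectivity. A nonzero value is then scaled to 1. *)
Lemma gform_nondeg j (v : V j) :
  v != 0 -> exists w : V (- (j + l)), gform g _ _ v w = 1.
Proof.
move=> v0; have [w gw] : exists w : V (- (j + l)), gform g _ _ v w != 0.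
  apply: contrapT => /forallNP H.
  have /bij_inj flat_inj := gform_flat g j.
  case/eqP: v0; apply: flat_inj; apply/lfunP => w.
  rewrite !gflatE linear0l; congr (_ * _).
  by apply/eqP; apply/negP => /negP; apply: H.
by exists ((gform g _ _ v w)^-1 *: w); rewrite linearZr_LR /= mulVf.
Qed.

Lemma gform_span0 i j (X : seq (V i)) (v : V i) (w : V j) :
  {in X, forall u, gform g _ _ u w = 0} -> v \in <<X>>%VS ->
  gform g _ _ v w = 0.
Proof.
move=> Xw vX; rewrite (coord_span (X := in_tuple X) vX) linear_sumlz.
rewrite big1 // => a _.
by rewrite linearZl_LR /= Xw ?mulr0 // mem_nth.
Qed.

(** * Families that admit a dual family *)

Section Dual.
Variables (K : finType) (b d : K -> homog V).
Hypothesis bd : forall i j, geval g (b i) (d j) = (i == j)%:R.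

Local Notation bseq j := [seq hcomp j (b i) | i <- enum K & hdeg (b i) == j].

(** Pairing with [d a] vanishes on the span of the other members but is 1 on [b a]. *)
Lemma dual_free j : free (bseq j).
Proof.
elim: (enum K) (enum_uniq K) => [|a s IHs] /=; first by rewrite nil_free.
case/andP=> a_s /IHs{}IHs; case: ifP => //= /eqP aj.
rewrite free_cons IHs andbT; apply/negP => a_span.
have := gform_hcompl j (b a) (d a); rewrite bd aj !eqxx.
rewrite (gform_span0 _ a_span) ?mul1r => [/esym/eqP|u]; first by rewrite oner_eq0.
case/mapP=> c; rewrite mem_filter => /andP[_ c_s] ->.
by rewrite gform_hcompl bd; case: (c =P a) c_s a_s => [->->|]; rewrite ?mulr0.
Qed.

Lemma dual_hdeg i : hdeg (d i) = - (hdeg (b i) + l).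
Proof.
have [/eqP|ne] := eqVneq (hdeg (b i) + hdeg (d i) + l) 0; first lia.
have /eqP := geval_deg ne; by rewrite bd eqxx oner_eq0.
Qed.

Lemma dual_gdim_neq0 i : gdim V (hdeg (b i)) != 0%N.
Proof.
apply/eqP => dim0; have := bd i i; rewrite eqxx /geval.
have -> : tagged (b i) = 0.
  apply/eqP; rewrite -memv0 -(_ : fullv = 0%VS) ?memvf //.
  by apply/eqP; rewrite -dimv_eq0; apply/eqP.
by rewrite linear0l => /esym/eqP; rewrite oner_eq0.
Qed.

(** Freeness in each degree bounds the family by the dimension; this bound makes the greedy
    extension terminate. *)
Lemma dual_card_le : (#|K| <= tdim V)%N.
Proof.
have [js [js_uniq jsP ->]] := tdim_bigE V.
rewrite (card_homog_family (b := b) js_uniq); last first.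
  by move=> i; exact/jsP/dual_gdim_neq0.
apply: leq_sum => j _; have /eqP <- := dual_free j.
exact: dimvS (subvf _).
Qed.

Lemma dual_card_basis : total_basis b -> tdim V = #|K|.
Proof.
move=> b_basis; have [js [js_uniq jsP ->]] := tdim_bigE V.
rewrite (card_homog_family (b := b) js_uniq); last first.
  by move=> i; exact/jsP/dual_gdim_neq0.
apply: eq_bigr => j _.
exact: (size_basis (X := in_tuple (bseq j)) (b_basis j)).
Qed.

(** The witness subtracts from [v] the sum of the [g(v, d i) b i]. The last clause lets pairings
    with vectors orthogonal to the family survive the projection. *)
Lemma dual_proj j (v : V j) : exists v' : V j,
  [/\ v - v' \in <<bseq j>>%VS,
      forall i, geval g (homog_of v') (d i) = 0
    & forall x, (forall i, geval g x (b i) = 0) ->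
        geval g x (homog_of v') = geval g x (homog_of v)].
Proof.
pose c i := geval g (homog_of v) (d i).
exists (v - \sum_i c i *: hcomp j (b i)); split.
- rewrite subKr; apply: memv_suml => i _; apply: memvZ.
  have [ij|/hcomp_neq->] := eqVneq (hdeg (b i)) j; last exact: mem0v.
  apply: memv_span; apply/mapP; exists i => //.
  by rewrite mem_filter ij eqxx mem_enum.
- move=> i; rewrite /geval /= linearBl linear_sumlz /=.
  rewrite (bigD1 i) //= big1 => [|a a_i]; last first.
    by rewrite linearZl_LR /= gform_hcompl bd (negPf a_i) !mulr0.
  rewrite linearZl_LR /= gform_hcompl bd eqxx addr0 mulr1.
  have [_|ne] := eqVneq (hdeg (b i)) j; first by rewrite mulr1 subrr.
  (* Here [b i] is not of degree [j], so the degrees of [v] and [d i] do not match and their pairing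
     is 0. *)
  rewrite mulr0 subr0; apply: (geval_deg (x := homog_of v)); rewrite dual_hdeg /hdeg /=.
  by apply: contraNneq ne; rewrite /hdeg; lia.
- move=> x xb; rewrite /geval /= linearBr linear_sumr big1 ?subr0 // => i _.
  by rewrite linearZr_LR /= gform_hcompr xb !mulr0.
Qed.

Hypothesis db : forall x,
  (forall i, geval g x (d i) = 0) -> forall i, geval g x (b i) = 0.

(** Projection gives orthogonality to the dual family [d]; the hypothesis [db] turns it into
    orthogonality to [b] itself. *)
Lemma dual_extend : ~ total_basis b -> exists x y,
  [/\ geval g x y = 1, hdeg y = - (hdeg x + l),
      forall i, geval g x (b i) = 0 & forall i, geval g y (b i) = 0].
Proof.
move=> /existsNP[j /negP]; rewrite -[map _ _]/(bseq j) => b_j.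
(* The members of degree [j] are free, so they can only fail to be a basis by not spanning. *)
have /subvPn[v _ v_span] : ~~ (fullv <= <<bseq j>>)%VS.
  apply: contra b_j => full.
  by rewrite basisEdim full /= -(eqP (dual_free j)) dimvS ?subvf.
have [v' [vv' /db v'b _]] := dual_proj v.
have v'0 : v' != 0 by apply: contraNneq v_span => v'0; rewrite -(subr0 v) -v'0.
have [w v'w] := gform_nondeg v'0.
have [w' [_ /db w'b w'E]] := dual_proj w.
exists (homog_of v'), (homog_of w'); split => //.
(* Replacing [w] by its projection keeps the value 1, because [v'] is orthogonal to the family. *)
by rewrite (w'E _ v'b).
Qed.

End Dual.
End Metric.

(** * Integer powers of -1 *)

Lemma signz_sqr (R : fieldType) (a : int) : (-1) ^ a * (-1) ^ a = 1 :> R.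
Proof. by rewrite -expfzMl mulrNN mulr1 exp1rz. Qed.

Lemma signz_neq0 (R : fieldType) (a : int) : (-1) ^ a != 0 :> R.
Proof. by rewrite expfz_neq0 // oppr_eq0 oner_neq0. Qed.

Lemma signz_even (R : fieldType) (a : int) : (2 %| a)%Z -> (-1) ^ a = 1 :> R.
Proof.
case/dvdzP=> c ->; have -> : c * 2 = c + c by lia.
by rewrite expfzDr ?signz_sqr // oppr_eq0 oner_neq0.
Qed.

Lemma signz_odd (R : fieldType) (a : int) : ~~ (2 %| a)%Z -> (-1) ^ a = -1 :> R.
Proof.
move=> a_odd; have -> : a = (a - 1) + 1 by rewrite subrK.
rewrite expfzDr ?oppr_eq0 ?oner_neq0 // signz_even ?mul1r //.
by move: a_odd; lia.
Qed.

Definition hscale (R : realType) (V : gradedVect R) (c : R) (x : homog V) :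
  homog V := homog_of (c *: tagged x).

(* The degree [-l/2], where [V_j] is paired with itself, carries a symmetric form
   when 4 divides l and a skew-symmetric one when l = 2 mod 4; hence the [e]
   part of a normal family is nonempty only when 4 divides l. *)
Record normal_family (R : realType) (V : gradedVect R) (l : int)
    (g : gmetric V l) (I E : finType) (t tb : I -> homog V) (e : E -> homog V)
    (s : E -> bool) : Prop := NormalFamily {
  nf_tdeg : forall i, 0 <= 2 * hdeg (t i) + l;
  nf_tdeg_sym : (4 %| l)%Z -> forall i, 0 < 2 * hdeg (t i) + l;
  nf_tbdeg : forall i, hdeg (tb i) = - (hdeg (t i) + l);
  nf_edeg : forall a, 2 * hdeg (e a) + l = 0;
  nf_esym : forall a : E, (4 %| l)%Z;
  nf_tt : forall i j, geval g (t i) (t j) = 0;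
  nf_ttb : forall i j, geval g (t i) (tb j) = (i == j)%:R;
  nf_tbtb : forall i j, geval g (tb i) (tb j) = 0;
  nf_te : forall i a, geval g (t i) (e a) = 0;
  nf_tbe : forall i a, geval g (tb i) (e a) = 0;
  nf_ee : forall a c, geval g (e a) (e c) = (-1) ^+ s a * (a == c)%:R }.

(** * Normal families and their extension to a basis *)

Section NormalFamily.
Variables (R : realType) (V : gradedVect R) (l : int) (g : gmetric V l).
Implicit Types x y z : homog V.

Lemma geval_scalel c x y : geval g (hscale c x) y = c * geval g x y.
Proof. exact: linearZl_LR. Qed.

Lemma geval_scaler c x y : geval g x (hscale c y) = c * geval g x y.
Proof. exact: linearZr_LR. Qed.

Section Family.
Variables (I E : finType) (t tb : I -> homog V) (e : E -> homog V).
Variable s : E -> bool.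
Hypothesis N : normal_family g t tb e s.

Local Notation b := (joinf (joinf t tb) e).

(** The factor [g(tb i, t i)] is a sign, hence its own inverse; so is the square of [e a]. *)
Definition normal_dual : I + I + E -> homog V :=
  joinf (joinf tb (fun i => hscale (geval g (tb i) (t i)) (t i)))
    (fun a => hscale ((-1) ^+ s a) (e a)).

Lemma nf_tbt i j : geval g (tb i) (t j)
  = (-1) ^ ((hdeg (tb i) + l) * (hdeg (t j) + l)) * (i == j)%:R.
Proof. by rewrite geval_sym (nf_ttb N) eq_sym. Qed.

Lemma nf_et a i : geval g (e a) (t i) = 0.
Proof. exact/geval_sym_eq0/(nf_te N). Qed.

Lemma nf_etb a i : geval g (e a) (tb i) = 0.
Proof. exact/geval_sym_eq0/(nf_tbe N). Qed.

Lemma normal_dualP i j : geval g (b i) (normal_dual j) = (i == j)%:R.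
Proof.
case: i j => [[]|] i [[]|] j /=; rewrite ?geval_scaler.
- exact: (nf_ttb N).
- by rewrite (nf_tt N) mulr0.
- by rewrite (nf_te N) mulr0.
- exact: (nf_tbtb N).
- rewrite !nf_tbt eqxx mulr1 -[RHS]/((i == j)%:R).
  by have [->|_] := eqVneq i j; rewrite ?mulr0 // mulr1 signz_sqr.
- by rewrite (nf_tbe N) mulr0.
- exact: nf_etb.
- by rewrite nf_et mulr0.
- rewrite (nf_ee N) -[RHS]/((i == j)%:R).
  by have [->|_] := eqVneq i j; rewrite ?mulr0 // mulr1 -expr2 sqrr_sign.
Qed.

(** Up to order and nonzero factors, [normal_dual] has the same members as the family. *)
Lemma normal_dual_orth x : (forall i, geval g x (normal_dual i) = 0) ->
  forall i, geval g x (b i) = 0.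
Proof.
move=> xd [[]|] i /=.
- have /eqP := xd (inl (inr i)); rewrite geval_scaler nf_tbt eqxx mulr1.
  by rewrite mulf_eq0 (negPf (signz_neq0 _ _)) => /eqP.
- exact: (xd (inl (inl i))).
- have /eqP := xd (inr i); rewrite geval_scaler.
  by rewrite mulf_eq0 signr_eq0 => /eqP.
Qed.

Lemma normal_card_le : (#|I| + #|I| + #|E| <= tdim V)%N.
Proof. by rewrite -!card_sum; exact: dual_card_le normal_dualP. Qed.

Lemma normal_card_basis : total_basis b -> tdim V = (#|I| + #|I| + #|E|)%N.
Proof. by rewrite -!card_sum; exact: dual_card_basis normal_dualP. Qed.

(** When 4 divides [l], every [t i] lies strictly above degree [-l/2] and every [tb i] strictly
    below, so only the [e a] remain in that degree. *)
Lemma normal_gdim j : total_basis b -> 2 * j + l = 0 -> (4 %| l)%Z ->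
  gdim V j = #|E|.
Proof.
move=> b_basis j0 l4.
rewrite [LHS](size_basis (X := in_tuple _) (b_basis j)) size_map size_filter.
rewrite -sum1_count big_enum_cond sum1_card -(card_codom (@inr_inj (I + I) E)).
apply: eq_card => i; rewrite -[LHS]/(hdeg (b i) == j); apply/eqP/codomP.
  case: i => [[]|] i /= ij; last by exists i.
    by have := nf_tdeg_sym N l4 i; move: ij j0; lia.
  by have := nf_tdeg_sym N l4 i; have := nf_tbdeg N i; move: ij j0; lia.
by case=> a ->; have := nf_edeg N a; rewrite /=; lia.
Qed.

(** The new pair is indexed by [None], where [oapp t x] and [oapp tb y] take the values [x] and
    [y]. *)
Lemma normal_add_pair x y : 0 <= 2 * hdeg x + l ->
  ((4 %| l)%Z -> 0 < 2 * hdeg x + l) -> hdeg y = - (hdeg x + l) ->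
  geval g x y = 1 -> geval g x x = 0 -> geval g y y = 0 ->
  (forall i, geval g x (b i) = 0) -> (forall i, geval g y (b i) = 0) ->
  normal_family g (oapp t x) (oapp tb y) e s.
Proof.
move=> xdeg xdeg_sym ydeg xy xx yy xb yb.
have xt i : geval g x (t i) = 0 := xb (inl (inl i)).
have xtb i : geval g x (tb i) = 0 := xb (inl (inr i)).
have xe a : geval g x (e a) = 0 := xb (inr a).
have yt i : geval g y (t i) = 0 := yb (inl (inl i)).
have ytb i : geval g y (tb i) = 0 := yb (inl (inr i)).
have ye a : geval g y (e a) = 0 := yb (inr a).
split.
- by case=> [i|] //=; exact: (nf_tdeg N).
- by move=> l4; case=> [i|] /=; [exact: (nf_tdeg_sym N) | exact: xdeg_sym].
- by case=> [i|] //=; exact: (nf_tbdeg N).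
- exact: (nf_edeg N).
- exact: (nf_esym N).
- case=> [i|] [j|] //=; [exact: (nf_tt N) | exact: geval_sym_eq0].
- case=> [i|] [j|] //=; first exact: (nf_ttb N).
  exact: geval_sym_eq0.
- case=> [i|] [j|] //=; [exact: (nf_tbtb N) | exact: geval_sym_eq0].
- by case=> [i|] a //=; exact: (nf_te N).
- by case=> [i|] a //=; exact: (nf_tbe N).
- exact: (nf_ee N).
Qed.

Lemma normal_add_square z (q : bool) : 2 * hdeg z + l = 0 -> (4 %| l)%Z ->
  geval g z z = (-1) ^+ q -> (forall i, geval g z (b i) = 0) ->
  normal_family g t tb (oapp e z) (oapp s q).
Proof.
move=> zdeg l4 zz zb.
have zt i : geval g z (t i) = 0 := zb (inl (inl i)).
have ztb i : geval g z (tb i) = 0 := zb (inl (inr i)).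
have ze a : geval g z (e a) = 0 := zb (inr a).
split.
- exact: (nf_tdeg N).
- exact: (nf_tdeg_sym N).
- exact: (nf_tbdeg N).
- by case=> [a|] //=; exact: (nf_edeg N).
- by [].
- exact: (nf_tt N).
- exact: (nf_ttb N).
- exact: (nf_tbtb N).
- move=> i [a|] /=; [exact: (nf_te N) | exact: geval_sym_eq0].
- move=> i [a|] /=; [exact: (nf_tbe N) | exact: geval_sym_eq0].
- case=> [a|] [c|] /=; rewrite ?mulr0 ?mulr1 //; first exact: (nf_ee N).
  exact: geval_sym_eq0.
Qed.

End Family.

(** Both factors of the sign exponent equal [l/2], which is even. *)
Lemma geval_sym_square x y : (4 %| l)%Z -> 2 * hdeg x + l = 0 ->
  hdeg y = hdeg x -> geval g x y = geval g y x.
Proof.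
move=> l4 xdeg ydeg; rewrite geval_sym ydeg signz_even ?mul1r //.
by apply: dvdz_mulr; move: l4 xdeg; lia.
Qed.

(* Some multiple of x, y or x + y has square +-1, since g(x, y) = 1. *)
Lemma exists_unit_square (K : finType) (b : K -> homog V) x y :
  (4 %| l)%Z -> 2 * hdeg x + l = 0 -> hdeg y = hdeg x -> geval g x y = 1 ->
  (forall i, geval g x (b i) = 0) -> (forall i, geval g y (b i) = 0) ->
  exists z (q : bool), [/\ hdeg z = hdeg x, geval g z z = (-1) ^+ q
    & forall i, geval g z (b i) = 0].
Proof.
move=> l4 xdeg ydeg xy xb yb.
have [z [zdeg zz zb]] : exists z, [/\ hdeg z = hdeg x, geval g z z != 0
    & forall i, geval g z (b i) = 0].
  have [xx|xx] := eqVneq (geval g x x) 0; last by exists x.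
  have [yy|yy] := eqVneq (geval g y y) 0; last by exists y.
  have yx : geval g y x = 1 by rewrite -geval_sym_square.
  case: x y xdeg ydeg {l4} xy xb yb xx yy yx => [j v] [j' w] /= _ jj'.
  (* Identifying the two degrees puts [v] and [w] in one component, so that [v + w] makes sense. *)
  rewrite /hdeg /= in jj'; case: _ / (esym jj') w => w vw vb wb vv ww wv.
  exists (homog_of (v + w)); split => //; last first.
    by move=> i; move: (vb i) (wb i); rewrite /geval linearDl => -> ->; rewrite addr0.
  (* With [v] and [w] isotropic, the square of [v + w] is [g(v, w) + g(w, v) = 2]. *)
  move: vw vv ww wv; rewrite /geval /= !(linearDl, linearDr) => -> -> -> ->.
  by rewrite add0r addr0 -mulr2n pnatr_eq0.
pose c := geval g z z.
(* The scaling divides the square by the absolute value of [c]; what is left is the sign of [c],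
   recorded by the boolean. *)
exists (hscale (Num.sqrt `|c|)^-1 z), (c < 0); split => //.
  rewrite geval_scalel geval_scaler mulrA -invfM -expr2 sqr_sqrtr //.
  by rewrite -/c {2}[c]realEsign ?num_real // mulrCA mulVf ?mulr1 ?normr_eq0.
by move=> i; rewrite geval_scalel zb mulr0.
Qed.

Lemma normal_extend (I E : finType) (t tb : I -> homog V) (e : E -> homog V)
    (s : E -> bool) :
  normal_family g t tb e s -> ~ total_basis (joinf (joinf t tb) e) ->
  exists (I' E' : finType) (t' tb' : I' -> homog V) (e' : E' -> homog V)
    (s' : E' -> bool), normal_family g t' tb' e' s' /\
    (#|I| + #|I| + #|E| < #|I'| + #|I'| + #|E'|)%N.
Proof.
move=> N nb; have [x [y [xy ydeg xb yb]]] :=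
  dual_extend (normal_dualP N) (normal_dual_orth N) nb.
have card_pair : (#|I| + #|I| + #|E| < #|{: option I}| + #|{: option I}| + #|E|)%N.
  by rewrite card_option; lia.
have [x0|x0] := eqVneq (2 * hdeg x + l) 0.
  have yx_deg : hdeg y = hdeg x by lia.
  have [l4|l4] := boolP (4 %| l)%Z.
    have [z [q [zdeg zz zb]]] := exists_unit_square l4 x0 yx_deg xy xb yb.
    exists I, (option E), t, tb, (oapp e z), (oapp s q); split.
      by apply: normal_add_square; rewrite ?zdeg.
    by rewrite card_option addnS.
  (* Here [|z| + l = l/2] is odd, so graded symmetry reads [g(z, z) = - g(z, z)]. *)
  have skew z : hdeg z = hdeg x -> geval g z z = 0.
    move=> zdeg; have := geval_sym g z z; rewrite signz_odd ?mulN1r.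
      by move/eqP; rewrite -addr_eq0 -mulr2n mulrn_eq0 => /eqP.
    rewrite zdeg dvdzE abszM Euclid_dvdM // orbb -dvdzE.
    by move: l4; lia.
  exists (option I), E, (oapp t x), (oapp tb y), e, s; split => //.
  apply: normal_add_pair; rewrite ?x0 ?skew //.
  by rewrite (negPf l4).
(* Outside degree [-l/2] the degree condition alone forces isotropy. *)
have iso z : 2 * hdeg z + l != 0 -> geval g z z = 0.
  by move=> z0; apply: geval_deg; apply: contraNneq z0; lia.
have xx : geval g x x = 0 by exact: iso.
have yy : geval g y y = 0 by apply: iso; rewrite ydeg; lia.
have [x_gt0|x_le0] := ltP 0 (2 * hdeg x + l).
  exists (option I), E, (oapp t x), (oapp tb y), e, s; split => //.
  by apply: normal_add_pair; rewrite // ltW.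
(* Now [x] lies below degree [-l/2] and [y] above it, so the roles are exchanged; rescaling [x]
   restores the value 1 in the reversed order. *)
have yx : geval g y x != 0 by rewrite geval_sym xy mulr1 signz_neq0.
pose x' := hscale (geval g y x)^-1 x.
exists (option I), E, (oapp t y), (oapp tb x'), e, s; split => //.
apply: normal_add_pair => //.
- by rewrite ydeg; lia.
- by rewrite ydeg; lia.
- by rewrite ydeg -[hdeg x']/(hdeg x); lia.
- by rewrite geval_scaler mulVf.
- by rewrite geval_scalel geval_scaler xx !mulr0.
- by move=> i; rewrite geval_scalel xb mulr0.
Qed.

Lemma exists_normal_basis :
  exists (I E : finType) (t tb : I -> homog V) (e : E -> homog V)
    (s : E -> bool), normal_family g t tb e s /\
    total_basis (joinf (joinf t tb) e).
Proof.
have extend n : forall (I E : finType) (t tb : I -> homog V) (e : E -> homog V)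
    (s : E -> bool), normal_family g t tb e s ->
    (tdim V - (#|I| + #|I| + #|E|) < n)%N ->
  exists (I' E' : finType) (t' tb' : I' -> homog V) (e' : E' -> homog V)
    (s' : E' -> bool), normal_family g t' tb' e' s' /\
    total_basis (joinf (joinf t' tb') e').
  elim: n => // n IHn I E t tb e s N card_n.
  have [?|nb] := pselect (total_basis (joinf (joinf t tb) e)).
    by exists I, E, t, tb, e, s.
  have [I' [E' [t' [tb' [e' [s' [N' lt_card]]]]]]] := normal_extend N nb.
  (* The subtraction is truncated, so its strict decrease also needs the larger family to have at
     most [tdim V] members. *)
  by apply: (IHn _ _ _ _ _ _ N'); have := normal_card_le N'; lia.
(* The extension starts from the empty family. *)
have N0 : normal_family g (@of_void _) (@of_void _) (@of_void _) (@of_void bool).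
  by split.
exact: (extend _ _ _ _ _ _ _ N0 (ltnSn _)).
Qed.

End NormalFamily.

(** * Indexing by ordinals and the final normal form *)

Lemma bij_sum (A A' B B' : Type) (f : A -> B) (f' : A' -> B') :
  bijective f -> bijective f' -> bijective (joinf (inl \o f) (inr \o f')).
Proof.
case=> h fK hK [h' fK' hK']; exists (joinf (inl \o h) (inr \o h')).
- by case=> a /=; rewrite ?fK ?fK'.
- by case=> a /=; rewrite ?hK ?hK'.
Qed.

Lemma ord_bij (I : finType) (n : nat) : #|I| = n ->
  exists f : 'I_n -> I, bijective f.
Proof. by move=> <-; exists enum_val; exact: enum_val_bij. Qed.

(** Indices where [s] is false are listed first. For the signs of a normal family, [p] thus counts
    the squares [+1] and [q] the squares [-1]. *)
Lemma ord_bij_split (E : finType) (s : pred E) :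
  exists (p q : nat) (f : 'I_(p + q) -> E),
    bijective f /\ forall a, s (f a) = (p <= a)%N.
Proof.
pose P := [pred x | ~~ s x].
pose h (u : 'I_#|P| + 'I_#|s|) : E :=
  match u with inl i => enum_val i | inr j => enum_val j end.
have sh u : s (h u) = (if u is inr _ then true else false).
  case: u => i /=; last exact: enum_valP.
  by apply/negbTE; exact: (enum_valP i).
have h_inj : injective h.
  move=> u u' huu'; have := congr1 s huu'; rewrite !sh.
  by case: u u' huu' => i [] j //= /enum_val_inj ->.
exists #|P|, #|s|, (h \o @fintype.split #|P| #|s|); split.
  apply: inj_card_bij; last by rewrite card_ord addnC cardC.
  exact: inj_comp h_inj (can_inj (@fintype.splitK #|P| #|s|)).
by move=> a; rewrite /= sh; case: splitP => i ->; rewrite ?leq_addr // leqNgt ltn_ord.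
Qed.

(** Brings the block matrix to the shape of [nf_ee], with the sign read off from the position
    relative to [p]. *)
Lemma minkowskiE (R : realType) (p q : nat) (a c : 'I_(p + q)) :
  minkowski R p q a c = (-1) ^+ (p <= a)%N * (a == c)%:R.
Proof.
rewrite -(fintype.splitK a) -(fintype.splitK c) /minkowski.
case: (fintype.split a) (fintype.split c) => i [] j /=;
  rewrite ?block_mxEul ?block_mxEur ?block_mxEdl ?block_mxEdr !mxE
    ?eq_lshift ?eq_rshift ?eq_lrshift ?eq_rlshift.
- by rewrite leqNgt ltn_ord mul1r.
- by rewrite mulr0.
- by rewrite mulr0.
- by rewrite leq_addr mulN1r.
Qed.

Theorem proposition10p1 (R : realType) (V : gradedVect R) (l : int)
    (g : gmetric V l) (V_neq0 : exists (j : int) (v : V j), v != 0) :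
  let n := tdim V in
  let k : int := - (l %/ 2)%Z in
  let eps : int := (l %% 2)%Z in
  (eps = 1 \/ (eps = 0 /\ ~~ (2 %| k)%Z) ->
   exists t tb : 'I_(n./2) -> homog V,
     [/\ total_basis (joinf t tb),
         forall a, k <= hdeg (t a),
         forall b, hdeg (tb b) = - hdeg (t b) + 2 * k - eps,
         forall a b, geval g (t a) (tb b) = (a == b)%:R
       & (forall a b, geval g (tb b) (t a)
            = (-1) ^ ((hdeg (tb b) + l) * (hdeg (t a) + l)) * (a == b)%:R) /\
         (forall a b, geval g (t a) (t b) = 0) /\
         (forall a b, geval g (tb a) (tb b) = 0)])
  /\
  (eps = 0 /\ (2 %| k)%Z ->
   let m := (n - gdim V k)%N in
   exists (p q : nat) (t tb : 'I_(m./2) -> homog V)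
          (e : 'I_(p + q) -> homog V),
     [/\ (p + q)%N = gdim V k,
         total_basis (joinf (joinf t tb) e),
         (forall a, k < hdeg (t a)) /\
         (forall b, hdeg (tb b) = - hdeg (t b) + 2 * k) /\
         (forall a, hdeg (e a) = k),
         (forall a b, geval g (t a) (tb b) = (a == b)%:R) /\
         (forall a b, geval g (e a) (e b) = minkowski R p q a b)
       & (forall a b, geval g (tb b) (t a)
            = (-1) ^ ((hdeg (tb b) + l) * (hdeg (t a) + l)) * (a == b)%:R) /\
         (forall a b, geval g (t a) (t b) = 0) /\
         (forall a b, geval g (tb a) (tb b) = 0) /\
         (forall a c, geval g (t a) (e c) = 0 /\ geval g (e c) (t a) = 0) /\
         (forall a c, geval g (tb a) (e c) = 0 /\ geval g (e c) (tb a) = 0)]).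
Proof.
move=> n k eps.
have [I [E [t [tb [e [s [N b_basis]]]]]]] := exists_normal_basis g.
have card_n := normal_card_basis N b_basis.
(* Quotients and remainders are dealt with here; [k] and [eps] are then generalized and only these
   three facts are kept. By [l4E], 4 divides [l] exactly in case (ii). *)
have l_k : l = - (2 * k) + eps by rewrite /k /eps; lia.
have l4E : (4 %| l)%Z = (eps == 0) && (2 %| k)%Z by rewrite /k /eps; lia.
have eps01 : eps = 0 \/ eps = 1 by rewrite /eps; lia.
move: l_k l4E eps01; rewrite -/k -/eps; move: k eps => k eps l_k l4E eps01.
split=> [not_sym | [eps0 k2] m].
(* A member of [E] would force 4 to divide [l], which case (i) excludes. *)
- have E0 : #|E| = 0%N.
    apply: eq_card0 => a; have := nf_esym N a; rewrite l4E.
    by case: not_sym => [->|[_ /negPf ->]]; rewrite ?andbF.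
  have [f f_bij] : exists f : 'I_(n./2) -> I, bijective f.
    by apply: ord_bij; rewrite /n card_n E0 addn0 addnn doubleK.
  have f_inj := bij_inj f_bij.
  exists (t \o f), (tb \o f); split.
  (* As [E] is empty, [inl] is already a bijection onto the whole index type. *)
  + have F_bij : bijective (@inl (I + I) E \o joinf (inl \o f) (inr \o f)).
      apply: bij_comp (bij_sum f_bij f_bij); apply: inj_card_bij inl_inj _.
      by rewrite !card_sum E0 addn0.
    apply: eq_total_basis (total_basis_reindex F_bij b_basis).
    by case.
  (* The bound says that the degree is at least [k - eps/2]; for [eps = 1] integrality rounds this
     up to [k]. *)
  + by move=> a; have := nf_tdeg N (f a); move: l_k eps01; rewrite /=; lia.
  + by move=> a; rewrite /= (nf_tbdeg N); lia.
  + by move=> a c; rewrite /= (nf_ttb N) (inj_eq f_inj).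
  + split; first by move=> a c; rewrite -(inj_eq f_inj) eq_sym; exact: (nf_tbt N).
    by split=> a c /=; rewrite ?(nf_tt N) ?(nf_tbtb N).
- have l4 : (4 %| l)%Z by rewrite l4E eps0 eqxx.
  have dim_k : gdim V k = #|E|.
    by apply: (normal_gdim N) => //; rewrite l_k eps0 addr0 subrr.
  have [f f_bij] : exists f : 'I_(m./2) -> I, bijective f.
    by apply: ord_bij; rewrite /m /n card_n dim_k addnK addnn doubleK.
  have f_inj := bij_inj f_bij.
  (* The [e] part is reordered with positive squares first, as the Minkowski matrix requires. *)
  have [p [q [h [h_bij sh]]]] := ord_bij_split s.
  exists p, q, (t \o f), (tb \o f), (e \o h); split.
  + by rewrite dim_k -(bij_eq_card h_bij) card_ord.
  + have := total_basis_reindex (bij_sum (bij_sum f_bij f_bij) h_bij) b_basis.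
    by apply: eq_total_basis; case=> [[]|].
  + split=> [a|]; first by have := nf_tdeg_sym N l4 (f a); rewrite /=; lia.
    split=> a /=; first by rewrite (nf_tbdeg N); lia.
    by have := nf_edeg N (h a); lia.
  + split=> a c /=; first by rewrite (nf_ttb N) (inj_eq f_inj).
    by rewrite (nf_ee N) minkowskiE sh (inj_eq (bij_inj h_bij)).
  + split; first by move=> a c; rewrite -(inj_eq f_inj) eq_sym; exact: (nf_tbt N).
    split; first by move=> a c; exact: (nf_tt N).
    split; first by move=> a c; exact: (nf_tbtb N).
    split=> a c /=; first by rewrite (nf_te N) (nf_et N).
    by rewrite (nf_tbe N) (nf_etb N).
Qed.
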